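(* Suppose $m=2k\in H_{\mathrm{even}}$ with $k$ odd and $k\ge 1$. Then: (1) every prime factor of $k$ is a 3-Higgs prime; (2) for every prime $q\mid k$, $v_q(k)\le 3$; (3) for every odd divisor $d\mid k$, $2d\in H_{\mathrm{even}}$. In other words, conditions (1) and (2) say that $k$ is Higgs-cubefree (a product of 3-Higgs primes each with multiplicity at most $3$), and condition (3) says that the set $S=\{k \text{ odd}: 2k\in H_{\mathrm{even}}\}$ is closed under taking odd divisors.
   Context: $v_q$ denotes the $q$-adic valuation. 3-Higgs primes are defined recursively: $2$ is 3-Higgs; an odd prime $p$ is 3-Higgs if and only if every prime factor $q$ of $p-1$ is a 3-Higgs prime (necessarily $q<p$) and satisfies $v_q(p-1)\le 3$ (including $v_2(p-1)\le 3$). $H$ is the set of integers $m\ge 1$ such that every prime factor of $2^m+1$ is 3-Higgs, and $H_{\mathrm{even}}=H\cap 2\mathbb{Z}$. *)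

(* Defs.v *)
From mathcomp Require Import all_boot.

Set Implicit Arguments.
Unset Strict Implicit.
Unset Printing Implicit Defensive.

(* A least fixed point is the same as recursion on p here, since every prime
   factor q of p.-1 is smaller than p. The valuation v_q(n) is logn q n. *)
Inductive higgs3 : nat -> Prop :=
| Higgs3_two : higgs3 2
| Higgs3_odd p : prime p -> odd p ->
    (forall q, prime q -> q %| p.-1 -> higgs3 q) ->
    (forall q, prime q -> q %| p.-1 -> logn q p.-1 <= 3) ->
    higgs3 p.

Lemma higgs3_oddE p : prime p -> odd p ->
  higgs3 p <->
  forall q, prime q -> q %| p.-1 -> higgs3 q /\ logn q p.-1 <= 3.
Proof.
move=> p_pr p_odd; split=> [hp | hp].
  by case: hp p_odd => // r _ _ hr vr _ q q_pr qr; split; [apply: hr | apply: vr].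
by apply: Higgs3_odd => // q q_pr /(hp q q_pr) [].
Qed.

Definition H (m : nat) : Prop :=
  1 <= m /\ forall p, prime p -> p %| 2 ^ m + 1 -> higgs3 p.

Definition Heven (m : nat) : Prop := H m /\ 2 %| m.

(* Main.v *)
Require Import Defs.
From mathcomp Require Import all_boot.
From mathcomp Require Import cyclic zify.

(** Both the bounds on [k] and its prime factors come from exhibiting, for each
    odd prime power [q ^ e] dividing [k] with [0 < e], a prime [p] such that
    [p %| 4 ^ q ^ e + 1] and [q ^ e %| p.-1] ([primitive_prime_expDn1], a case
    of Zsigmondy's theorem).  As [4 ^ q ^ e + 1] divides
    [4 ^ k + 1 = 2 ^ m + 1], the prime [p] is 3-Higgs, so that [q], a prime
    factor of [p.-1], is 3-Higgs, and [e <= logn q p.-1 <= 3].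

    To find [p], put [x = 4 ^ q ^ e.-1] and let [N] be the cofactor of [x + 1]
    in [x ^ q + 1].  A prime factor of [N] that does not divide [x + 1] is as
    wanted, since the order of [4] modulo it is a multiple of [q ^ e].  If there
    were none, [N] would be a power of [q], because [q] is the only prime that
    can divide both [N] and [x + 1]; but then [q ^ 2] does not divide [N], so
    that [N <= q], which is false because [N] is too large.

    Closure under odd divisors is the divisibility of [y ^ n + 1] by [y + 1] for
    odd [n], applied to [y = 4 ^ d]. *)

Lemma dvdn_addn1_expn x n : odd n -> x + 1 %| x ^ n + 1.
Proof.
case: x => [|x] n_odd; first exact: dvd1n.
rewrite -(odd_double_half n) n_odd add1n.
elim: n./2 => [|j IHj]; first by rewrite expn1.
rewrite -(dvdn_addl _ (dvdn_mulr x (dvdnn (x.+1 + 1)))).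
have -> : x.+1 ^ j.+1.*2.+1 + 1 + (x.+1 + 1) * x
          = x.+1 ^ 2 * (x.+1 ^ j.*2.+1 + 1).
  by rewrite doubleS 2!expnS; nia.
exact: dvdn_mull.
Qed.

Lemma expn_gcd_eq1 a p m n : 0 < m ->
  a ^ m = 1 %[mod p] -> a ^ n = 1 %[mod p] -> a ^ gcdn m n = 1 %[mod p].
Proof.
move=> m_gt0 am an.
have [u v def_g _] := egcdnP n m_gt0.
have powers_eq1 c l : a ^ l = 1 %[mod p] -> a ^ (c * l) = 1 %[mod p].
  by move=> al; rewrite mulnC expnM -modnXm al modnXm exp1n.
have := powers_eq1 u m am.
by rewrite def_g expnD -modnMml powers_eq1 // modnMml mul1n.
Qed.

(** Modulo [q ^ 2] one has [y ^ i = 1 + i * (y - 1)], so the sum is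
    [q + 'C(q, 2) * (y - 1)], and ['C(q, 2)] is a multiple of the odd [q]. *)
Lemma geometric_sum_mod_sqr q y : odd q -> y = 1 %[mod q] -> 0 < y ->
  \sum_(i < q) y ^ i = q %[mod q ^ 2].
Proof.
move=> q_odd y1 y_gt0.
have [s def_y] : exists s, y = 1 + q * s.
  exists (y.-1 %/ q); rewrite mulnC divnK; first lia.
  by rewrite -subn1 -eqn_mod_dvd // y1.
have pow_mod i : y ^ i = 1 + i * (q * s) %[mod q ^ 2].
  elim: i => [|i IHi]; first by rewrite mul0n addn0.
  rewrite expnS -modnMmr IHi modnMmr.
  have -> : y * (1 + i * (q * s))
            = i * s ^ 2 * q ^ 2 + (1 + i.+1 * (q * s)) by rewrite def_y; nia.
  by rewrite modnMDl.
rewrite -modn_summ (eq_bigr (fun i : 'I_q => (1 + i * (q * s)) %% q ^ 2)).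
  rewrite modn_summ big_split /= sum1_card card_ord -big_distrl /=.
  rewrite -(big_mkord xpredT id) bin2_sum bin2odd //.
  have -> : q + q * q.-1./2 * (q * s) = q.-1./2 * s * q ^ 2 + q by nia.
  by rewrite modnMDl.
by move=> i _; apply: pow_mod.
Qed.

Lemma geometric_sum_mod p y n : y = 1 %[mod p] ->
  \sum_(i < n) y ^ i = n %[mod p].
Proof.
move=> y1; rewrite -modn_summ (eq_bigr (fun=> 1 %% p)).
  by rewrite modn_summ sum1_card card_ord.
by move=> i _; rewrite -modnXm y1 modnXm exp1n.
Qed.

(** Passing to squares replaces the alternating sum [N] by a divisor of a
    geometric sum without signs, to which congruences in [nat] apply. *)
Lemma cofactor_dvd_geometric_sum x q N : 1 < x ->
  x ^ q + 1 = (x + 1) * N -> N %| \sum_(i < q) (x ^ 2) ^ i.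
Proof.
move=> x_gt1 defN; apply/dvdnP; exists (\sum_(i < q) x ^ i).
have x2_gt0 : 0 < (x ^ 2).-1 by nia.
apply/eqP; rewrite -(eqn_pmul2l x2_gt0) -predn_exp; apply/eqP.
have -> : (x ^ 2).-1 = (x + 1) * x.-1 by nia.
rewrite -expnM mulnC expnM.
have -> : ((x ^ q) ^ 2).-1 = (x ^ q).-1 * (x ^ q + 1) by nia.
by rewrite defN predn_exp; nia.
Qed.

Lemma sqrn_eq1_mod p x : p %| x + 1 -> 0 < x -> x ^ 2 = 1 %[mod p].
Proof.
move=> px x_gt0; apply/eqP; rewrite eqn_mod_dvd ?expn_gt0 ?x_gt0 //.
by rewrite -[1](exp1n 2) subn_sqr dvdn_mull.
Qed.

Lemma mul_addn1_lt_expn x q : 2 < x -> 2 < q -> q * (x + 1) < x ^ q + 1.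
Proof.
move=> x_gt2; case: q => [|[|[|q]]] // _.
elim: q => [|q IHq]; first by rewrite !expnS expn0; nia.
by rewrite expnS; nia.
Qed.

(** Modulo a common prime factor of [x + 1] and of the cofactor [N], the
    geometric sum in [x ^ 2] is both [q] and a multiple of [N], so only [q] can
    be such a factor; and [N] is not [q] or [1] by size, nor a multiple of
    [q ^ 2] when [q] divides [x + 1]. *)
Lemma exists_new_prime x q : 2 < x -> prime q -> odd q ->
  exists p, [/\ prime p, p %| x ^ q + 1 & ~~ (p %| x + 1)].
Proof.
move=> x_gt2 q_pr q_odd.
have q_gt2 : 2 < q by rewrite odd_prime_gt2.
have /dvdnP[N] := dvdn_addn1_expn x _ q_odd; rewrite mulnC => defN.
have N_gt_q : q < N.
  by have := mul_addn1_lt_expn _ _ x_gt2 q_gt2; rewrite defN; nia.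
have N_dvd_sum := cofactor_dvd_geometric_sum _ _ _ (ltnW x_gt2) defN.
have [/hasP[p] | /hasPn none] :=
  boolP (has (fun p => ~~ (p %| x + 1)) (primes N)).
  rewrite mem_primes => /and3P[p_pr _ pN] px; exists p; split=> //.
  by rewrite defN dvdn_mull.
exfalso.
have prime_factor_q p : prime p -> p %| N -> p %| x + 1 /\ p = q.
  move=> p_pr pN.
  have px : p %| x + 1.
    by apply/negPn/none; rewrite mem_primes p_pr pN; lia.
  split=> //; apply/eqP; rewrite -dvdn_prime2 //.
  have := geometric_sum_mod _ _ q (sqrn_eq1_mod _ _ px (ltnW (ltnW x_gt2))).
  by rewrite /dvdn => <-; rewrite -/(dvdn _ _) (dvdn_trans pN).
have qN : q %| N.
  have N_gt1 : 1 < N by lia.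
  by have [_ <-] := prime_factor_q _ (pdiv_prime N_gt1) (pdiv_dvd N);
    apply: pdiv_dvd.
have [qx _] := prime_factor_q q q_pr qN.
have /p_natP[j defNj] : q.-nat N.
  apply/pnatP=> [|p p_pr pN]; first lia.
  by have [_ ->] := prime_factor_q p p_pr pN; rewrite inE.
have j_gt1 : 1 < j.
  by rewrite -(ltn_exp2l _ _ (prime_gt1 q_pr)) -defNj expn1.
have q2N : q ^ 2 %| N by rewrite defNj dvdn_exp2l.
have x2_gt0 : 0 < x ^ 2 by rewrite expn_gt0; lia.
have := geometric_sum_mod_sqr _ _ q_odd
          (sqrn_eq1_mod _ _ qx (ltnW (ltnW x_gt2))) x2_gt0.
move/eqP; rewrite (eqP (dvdn_trans q2N N_dvd_sum)) modn_small; first lia.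
by rewrite -{1}(expn1 q) ltn_exp2l // prime_gt1.
Qed.

(** The order of [a] modulo [p] divides [2 * q ^ f.+1] and [p.-1].  If
    [q ^ f.+1] did not divide [p.-1], the order would divide [2 * q ^ f], so
    that [x = a ^ q ^ f] would satisfy [x ^ 2 = 1], whence [x = x ^ q = -1]
    modulo [p]. *)
Lemma dvdn_pred_of_new_prime a q f p : prime p -> prime q -> odd q ->
  p %| a ^ (q ^ f.+1) + 1 -> ~~ (p %| a ^ (q ^ f) + 1) -> q ^ f.+1 %| p.-1.
Proof.
move=> p_pr q_pr q_odd p_new; apply: contraNT => q_ndvd.
have q_gt0 := prime_gt0 q_pr.
have pa : ~~ (p %| a).
  apply: contraL p_new => pa; rewrite dvdn_addr ?dvdn1.
    by rewrite neq_ltn prime_gt1 ?orbT.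
  by rewrite dvdn_exp // expn_gt0 q_gt0.
have a_gt0 : 0 < a by case: a pa {p_new} => //; rewrite dvdn0.
have am : a ^ (2 * q ^ f.+1) = 1 %[mod p].
  by rewrite mulnC expnM sqrn_eq1_mod ?expn_gt0 ?a_gt0.
have an : a ^ p.-1 = 1 %[mod p].
  rewrite -(totient_prime p_pr) Euler_exp_totient //.
  by rewrite coprime_sym prime_coprime.
have m_gt0 : 0 < 2 * q ^ f.+1 by rewrite muln_gt0 expn_gt0 q_gt0.
have := expn_gcd_eq1 _ _ _ _ m_gt0 am an; set g := gcdn _ _ => ag.
have /dvdnP[c def_c] : g %| 2 * q ^ f.
  have [i le_i def_h] : exists2 i, i <= f.+1 & gcdn g (q ^ f.+1) = q ^ i.
    by apply/dvdn_pfactor; rewrite ?dvdn_gcdr.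
  have le_i_f : i <= f.
    rewrite -ltnS ltn_neqAle le_i andbT; apply: contraNneq q_ndvd => <-.
    by rewrite -def_h (dvdn_trans (dvdn_gcdl _ _)) ?dvdn_gcdr.
  apply: (@dvdn_trans (2 * gcdn g (q ^ f.+1))).
    by rewrite muln_gcdr dvdn_gcd dvdn_mull ?dvdn_gcdl.
  by rewrite def_h dvdn_pmul2l ?dvdn_exp2l.
have x2 : (a ^ (q ^ f)) ^ 2 = 1 %[mod p].
  by rewrite -expnM mulnC def_c mulnC expnM -modnXm ag modnXm exp1n.
move: p_new; rewrite expnSr expnM; set x := a ^ (q ^ f) in x2 *.
have xq : x ^ q = x %[mod p].
  rewrite -(odd_double_half q) q_odd add1n expnS -mul2n expnM.
  by rewrite -modnMmr -modnXm x2 modnXm exp1n modnMmr muln1.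
by rewrite /dvdn -modnDml xq modnDml.
Qed.

Lemma primitive_prime_expDn1 a q e : 2 < a -> prime q -> odd q -> 0 < e ->
  exists p, [/\ prime p, p %| a ^ (q ^ e) + 1 & q ^ e %| p.-1].
Proof.
move=> a_gt2 q_pr q_odd; case: e => // f _.
have x_gt2 : 2 < a ^ (q ^ f).
  apply: (leq_trans a_gt2); rewrite -{1}(expn1 a).
  by apply: leq_pexp2l; [lia | rewrite expn_gt0 prime_gt0].
have [p [p_pr p_dvd p_new]] := exists_new_prime _ _ x_gt2 q_pr q_odd.
move: p_dvd; rewrite -expnM -expnSr => p_dvd.
exists p; split=> //; exact: dvdn_pred_of_new_prime p_dvd p_new.
Qed.

Lemma dvdn_exp2_addn1 k d : odd k -> d %| k ->
  2 ^ (2 * d) + 1 %| 2 ^ (2 * k) + 1.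
Proof.
move=> k_odd /dvdnP[c def_k]; rewrite def_k mulnCA (mulnC c) (expnM 2 (2 * d)).
by apply: dvdn_addn1_expn; move: k_odd; rewrite def_k oddM => /andP[].
Qed.

Theorem proposition5 (m k : nat) (hmk : m = 2 * k) (hm : Heven m)
    (hk_odd : odd k) (hk1 : 1 <= k) :
  [/\ forall q, prime q -> q %| k -> higgs3 q,
      forall q, prime q -> q %| k -> logn q k <= 3
    & forall d, odd d -> d %| k -> Heven (2 * d)].
Proof.
move: hm; rewrite hmk => -[[_ higgs_factors] _].
have prime_power q e : prime q -> 0 < e -> q ^ e %| k -> higgs3 q /\ e <= 3.
  move=> q_pr e_gt0 qe_k.
  have q_p : q %| q ^ e by rewrite dvdn_exp.
  have q_odd : odd q by apply: dvdn_odd hk_odd; apply: dvdn_trans qe_k.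
  have [p [p_pr p_dvd qe_p]] : exists p,
      [/\ prime p, p %| 4 ^ (q ^ e) + 1 & q ^ e %| p.-1].
    exact: primitive_prime_expDn1.
  have p_dvd_m : p %| 2 ^ (2 * k) + 1.
    apply: dvdn_trans (dvdn_exp2_addn1 _ _ hk_odd qe_k).
    by rewrite expnM.
  have p_odd : odd p.
    apply: dvdn_odd p_dvd_m _.
    by rewrite oddD oddX muln_eq0 /= orbF (gtn_eqF hk1).
  have /(higgs3_oddE p_pr p_odd) higgs_p := higgs_factors p p_pr p_dvd_m.
  have [q_higgs le3] := higgs_p q q_pr (dvdn_trans q_p qe_p).
  split=> //; apply: leq_trans le3.
  by rewrite -pfactor_dvdn //; have := prime_gt1 p_pr; lia.
split=> [q q_pr qk | q q_pr qk | d d_odd dk].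
- by have [|] := prime_power q 1 q_pr isT; rewrite ?expn1.
- have e_gt0 : 0 < logn q k by rewrite -pfactor_dvdn // expn1.
  by have [] := prime_power q (logn q k) q_pr e_gt0 (pfactor_dvdnn q k).
- split; last exact: dvdn_mulr.
  split=> [|p p_pr pd]; first by have := odd_gt0 d_odd; lia.
  exact: higgs_factors (dvdn_trans pd (dvdn_exp2_addn1 _ _ hk_odd dk)).
Qed.
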